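(* Let $S$ be a finite set of sequents in the language of $\mathbf{ACT}_\omega$. For each sequent $A_1,\ldots,A_n\Rightarrow B$ in $S$ consider the formula $(A_1\cdot\ldots\cdot A_n)\backslash B$ if $n\ge1$, and the formula $B$ if $n=0$; let $\Upsilon_S$ be a sequence consisting of all these formulas in an arbitrary order, and let $!\Upsilon_S$ be the sequence obtained by prefixing $!$ to each of them. Then for every sequent $\Pi\Rightarrow C$ of $\mathbf{ACT}_\omega$: $\Pi\Rightarrow C$ is derivable in $\mathbf{ACT}_\omega$ from $S$ if and only if $!\Upsilon_S,\Pi\Rightarrow C$ is derivable in $!\mathbf{ACT}_\omega$ (without hypotheses).
   Context: Formulas of $!\mathbf{ACT}_\omega$ are built from a countable set of variables and constants $0,1$ using binary $\backslash$, $/$, $\cdot$, $\oplus$, $\&$, unary postfix ${}^*$ and unary prefix $!$; formulas without $!$ are the formulas of $\mathbf{ACT}_\omega$. A sequent is $\Pi\Rightarrow B$ ($\Pi$ a finite, possibly empty, sequence of formulas); $A^n$ is $n$ copies of $A$; $!\Pi$ is a sequence of formulas of the form $!A$. $\mathbf{ACT}_\omega$ has axioms $A\Rightarrow A$, $\ \Rightarrow1$, $\ \Gamma,0,\Delta\Rightarrow C$, $\ \Rightarrow A^*$ and rules (premises / conclusion): ($\backslash L$) $\Pi\Rightarrow A$, $\Gamma,B,\Delta\Rightarrow C$ / $\Gamma,\Pi,A\backslash B,\Delta\Rightarrow C$; ($\backslash R$) $A,\Pi\Rightarrow B$ / $\Pi\Rightarrow A\backslash B$; ($/L$) $\Pi\Rightarrow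 A$, $\Gamma,B,\Delta\Rightarrow C$ / $\Gamma,B/A,\Pi,\Delta\Rightarrow C$; ($/R$) $\Pi,A\Rightarrow B$ / $\Pi\Rightarrow B/A$; ($\cdot L$) $\Gamma,A,B,\Delta\Rightarrow C$ / $\Gamma,A\cdot B,\Delta\Rightarrow C$; ($\cdot R$) $\Gamma\Rightarrow A$, $\Delta\Rightarrow B$ / $\Gamma,\Delta\Rightarrow A\cdot B$; ($1L$) $\Gamma,\Delta\Rightarrow C$ / $\Gamma,1,\Delta\Rightarrow C$; ($\oplus L$) $\Gamma,A_1,\Delta\Rightarrow C$, $\Gamma,A_2,\Delta\Rightarrow C$ / $\Gamma,A_1\oplus A_2,\Delta\Rightarrow C$; ($\oplus R_i$) $\Pi\Rightarrow A_i$ / $\Pi\Rightarrow A_1\oplus A_2$; ($\&L_i$) $\Gamma,A_i,\Delta\Rightarrow C$ / $\Gamma,A_1\&A_2,\Delta\Rightarrow C$; ($\&R$) $\Pi\Rightarrow A_1$, $\Pi\Rightarrow A_2$ / $\Pi\Rightarrow A_1\&A_2$; (${}^*L_\omega$) $(\Gamma,A^n,\Delta\Rightarrow C)_{n\in\omega}$ / $\Gamma,A^*,\Delta\Rightarrow C$; (${}^*R_n$, $n\ge1$) $\Pi_1\Rightarrow A,\dots,\Pi_n\Rightarrow A$ / $\Pi_1,\dots,\Pi_n\Rightarrow A^*$; (Cut) $\Pi\Rightarrow A$, $\Gamma,A,\Delta\Rightarrow C$ / $\Gamma,\Pi,\Delta\Rightarrow C$. $!\mathbf{ACT}_\omega$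 has in addition: ($!L$) $\Gamma,A,\Delta\Rightarrow C$ / $\Gamma,!A,\Delta\Rightarrow C$; ($!R$) $!\Pi\Rightarrow B$ / $!\Pi\Rightarrow!B$; ($!P_1$) $\Gamma,\Pi,!A,\Delta\Rightarrow C$ / $\Gamma,!A,\Pi,\Delta\Rightarrow C$; ($!P_2$) $\Gamma,!A,\Pi,\Delta\Rightarrow C$ / $\Gamma,\Pi,!A,\Delta\Rightarrow C$; ($!W$) $\Gamma,\Delta\Rightarrow C$ / $\Gamma,!A,\Delta\Rightarrow C$; ($!C$) $\Gamma,!A,!A,\Delta\Rightarrow C$ / $\Gamma,!A,\Delta\Rightarrow C$. Sequents derivable from a set of hypotheses $S$ form the least set containing the axioms and the members of $S$ and closed under the rules (derivations are well-founded, possibly infinite trees). *)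

(* Defs.v *)
From Stdlib Require Import Bool List Permutation.
Import ListNotations.

Set Implicit Arguments.

(** One type family covers both languages.  [form false] is the language of
    ACT_omega: there [Is_true false] is [False], so [Bang] cannot be applied.
    [form true] is the language of !ACT_omega, where the proof argument of
    [Bang] lives in [True]. *)
Inductive form (b : bool) : Type :=
| Var : nat -> form b
| Zero : form b
| One : form b
| LDiv : form b -> form b -> form b  (* [LDiv A B] is A \ B *)
| RDiv : form b -> form b -> form b  (* [RDiv B A] is B / A *)
| Prod : form b -> form b -> form b
| Plus : form b -> form b -> form b
| With : form b -> form b -> form b
| Star : form b -> form b
| Bang : Is_true b -> form b -> form b.

Arguments Var {b} _.
Arguments Zero {b}.
Arguments One {b}.

Definition act_form : Type := form false.
Definition bang_act_form : Type := form true.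

Definition bang (A : bang_act_form) : bang_act_form := @Bang true I A.

Fixpoint embed (b : bool) (A : form b) : bang_act_form :=
  match A with
  | Var n => Var n
  | Zero => Zero
  | One => One
  | LDiv A B => LDiv (embed A) (embed B)
  | RDiv B A => RDiv (embed B) (embed A)
  | Prod A B => Prod (embed A) (embed B)
  | Plus A B => Plus (embed A) (embed B)
  | With A B => With (embed A) (embed B)
  | Star A => Star (embed A)
  | Bang _ A => bang (embed A)
  end.

(** The pair [(Pi, B)] is the sequent Pi => B. *)
Definition sequent (b : bool) : Type := (list (form b) * form b)%type.

(** [derivable S Pi B]: the sequent Pi => B is derivable from the set of
    hypotheses [S], in ACT_omega when [b = false] and in !ACT_omega when
    [b = true].  An inductive proposition with the infinitely branching
    constructor [StarL] is the least set closed under the rules. *)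
Inductive derivable (b : bool) (S : sequent b -> Prop) :
  list (form b) -> form b -> Prop :=
| Hyp Pi B : S (Pi, B) -> derivable S Pi B
| Ax A : derivable S [A] A
| OneR : derivable S [] One
| ZeroL G D C : derivable S (G ++ Zero :: D) C
| StarR0 A : derivable S [] (Star A)
| LDivL Pi A B G D C :
    derivable S Pi A -> derivable S (G ++ B :: D) C ->
    derivable S (G ++ Pi ++ LDiv A B :: D) C
| LDivR Pi A B :
    derivable S (A :: Pi) B -> derivable S Pi (LDiv A B)
| RDivL Pi A B G D C :
    derivable S Pi A -> derivable S (G ++ B :: D) C ->
    derivable S (G ++ RDiv B A :: Pi ++ D) C
| RDivR Pi A B :
    derivable S (Pi ++ [A]) B -> derivable S Pi (RDiv B A)
| ProdL A B G D C :
    derivable S (G ++ A :: B :: D) C -> derivable S (G ++ Prod A B :: D) C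
| ProdR A B G D :
    derivable S G A -> derivable S D B -> derivable S (G ++ D) (Prod A B)
| OneL G D C :
    derivable S (G ++ D) C -> derivable S (G ++ One :: D) C
| PlusL A1 A2 G D C :
    derivable S (G ++ A1 :: D) C -> derivable S (G ++ A2 :: D) C ->
    derivable S (G ++ Plus A1 A2 :: D) C
| PlusR1 Pi A1 A2 : derivable S Pi A1 -> derivable S Pi (Plus A1 A2)
| PlusR2 Pi A1 A2 : derivable S Pi A2 -> derivable S Pi (Plus A1 A2)
| WithL1 A1 A2 G D C :
    derivable S (G ++ A1 :: D) C -> derivable S (G ++ With A1 A2 :: D) C
| WithL2 A1 A2 G D C :
    derivable S (G ++ A2 :: D) C -> derivable S (G ++ With A1 A2 :: D) C
| WithR Pi A1 A2 :
    derivable S Pi A1 -> derivable S Pi A2 -> derivable S Pi (With A1 A2)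
| StarL A G D C :
    (forall n : nat, derivable S (G ++ repeat A n ++ D) C) ->
    derivable S (G ++ Star A :: D) C
| StarR A (Pis : list (list (form b))) :
    Pis <> [] ->
    (forall Pi, In Pi Pis -> derivable S Pi A) ->
    derivable S (concat Pis) (Star A)
| Cut Pi A G D C :
    derivable S Pi A -> derivable S (G ++ A :: D) C ->
    derivable S (G ++ Pi ++ D) C
| BangL (h : Is_true b) A G D C :
    derivable S (G ++ A :: D) C -> derivable S (G ++ Bang h A :: D) C
| BangR (h : Is_true b) Pi B :
    derivable S (map (Bang h) Pi) B ->
    derivable S (map (Bang h) Pi) (Bang h B)
| BangP1 (h : Is_true b) A Pi G D C :
    derivable S (G ++ Pi ++ Bang h A :: D) C ->
    derivable S (G ++ Bang h A :: Pi ++ D) C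
| BangP2 (h : Is_true b) A Pi G D C :
    derivable S (G ++ Bang h A :: Pi ++ D) C ->
    derivable S (G ++ Pi ++ Bang h A :: D) C
| BangW (h : Is_true b) A G D C :
    derivable S (G ++ D) C -> derivable S (G ++ Bang h A :: D) C
| BangC (h : Is_true b) A G D C :
    derivable S (G ++ Bang h A :: Bang h A :: D) C ->
    derivable S (G ++ Bang h A :: D) C.

Definition act_derivable (S : sequent false -> Prop)
  (Pi : list act_form) (C : act_form) : Prop := derivable S Pi C.

Definition bang_act_derivable (Pi : list bang_act_form) (C : bang_act_form) :
  Prop := derivable (fun _ : sequent true => False) Pi C.

(** Products A_1 . ... . A_n are bracketed to the left. *)
Definition sequent_formula (s : sequent false) : act_form :=
  match s with
  | ([], B) => B
  | (A :: As, B) => LDiv (fold_left (@Prod false) As A) B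
  end.

(* Main.v *)
Require Import Defs.
From Stdlib Require Import Bool List Permutation.
From Stdlib Require Import ClassicalEpsilon.
Import ListNotations.

Set Implicit Arguments.

(** From left to right, the hypotheses in [S] become derivable once the context
    [!Upsilon] is added to every sequent, and the rules with several premises are
    repaired by contracting the copies of that context.

    From right to left, no cut elimination is needed: modulo derivability from
    [S], the modality can be interpreted by sending [!A] to [1] if [A] is
    derivable from [S] and to [0] otherwise.  All rules of !ACT_omega are sound
    for this interpretation, it is the identity on ACT_omega, and it sends every
    formula of [!Upsilon] to [1]. *)

Ltac list_eq := repeat (rewrite <- ?app_assoc; simpl); reflexivity.

(** Serves to apply a rule whose conclusion fits the goal only up to reassociating [++]. *)
Lemma derivable_cast b (S : sequent b -> Prop) Pi Pi' C :
  derivable S Pi C -> Pi = Pi' -> derivable S Pi' C.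
Proof. now intros H <-. Qed.

(** * Structural rules for whole contexts of [!]-formulas *)

Section BangContexts.
Context {b : bool} (h : Is_true b) (S : sequent b -> Prop).

Lemma bangs_weaken V : forall G D C,
  derivable S (G ++ D) C -> derivable S (G ++ map (Bang h) V ++ D) C.
Proof.
induction V as [|A V IH]; intros G D C H; simpl; [exact H|].
apply BangW. now apply IH.
Qed.

Lemma bangs_move_left V : forall G Pi D C,
  derivable S (G ++ Pi ++ map (Bang h) V ++ D) C ->
  derivable S (G ++ map (Bang h) V ++ Pi ++ D) C.
Proof.
induction V as [|A V IH]; intros G Pi D C H; simpl in *; [exact H|].
apply BangP1 in H.
apply derivable_cast with (2 := eq_sym (app_assoc G [Bang h A] _)).
apply IH. apply derivable_cast with (1 := H). list_eq.
Qed.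

Lemma bangs_move_right V G Pi D C :
  derivable S (G ++ map (Bang h) V ++ Pi ++ D) C ->
  derivable S (G ++ Pi ++ map (Bang h) V ++ D) C.
Proof.
revert G Pi D C.
induction V as [|A V IH]; intros G Pi D C H; simpl in *; [exact H|].
apply BangP2.
apply derivable_cast with (2 := eq_sym (app_assoc G [Bang h A] _)).
apply IH. apply derivable_cast with (1 := H). list_eq.
Qed.

(** Read backwards: the tail is doubled first, then the head [!A], whose second copy is exchanged
    past the first copy of the tail. *)
Lemma bangs_contract V : forall G D C,
  derivable S (G ++ map (Bang h) V ++ map (Bang h) V ++ D) C ->
  derivable S (G ++ map (Bang h) V ++ D) C.
Proof.
induction V as [|A V IH]; intros G D C H; simpl in *; [exact H|].
apply derivable_cast with (2 := eq_sym (app_assoc G [Bang h A] _)).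
apply IH.
apply derivable_cast with (2 := app_assoc G [Bang h A] _); simpl.
apply BangC.
apply derivable_cast with (2 := eq_sym (app_assoc G [Bang h A] _)).
apply BangP1. apply derivable_cast with (1 := H). list_eq.
Qed.

Lemma bangs_absorb V G D C :
  derivable S (map (Bang h) V ++ G ++ map (Bang h) V ++ D) C ->
  derivable S (map (Bang h) V ++ G ++ D) C.
Proof.
intro H. apply (bangs_contract V []). simpl.
apply bangs_move_left. exact H.
Qed.

(** Needed for [StarR], where every premise brings its own copy of [!V]; [G] collects the blocks
    already freed of theirs. *)
Lemma bangs_absorb_concat V Pis : forall G C,
  derivable S (map (Bang h) V ++ G ++ concat (map (app (map (Bang h) V)) Pis)) C ->
  derivable S (map (Bang h) V ++ G ++ concat Pis) C.
Proof.
induction Pis as [|Pi Pis IH]; intros G C H; simpl in *; [exact H|].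
rewrite (app_assoc G). apply IH. rewrite <- app_assoc.
apply bangs_absorb. apply derivable_cast with (1 := H). list_eq.
Qed.

End BangContexts.

(** * Left-bracketed products and the formulas coding sequents *)

Lemma derivable_fold_prod b (S : sequent b -> Prop) As : forall Pi A,
  derivable S Pi A -> derivable S (Pi ++ As) (fold_left (@Prod b) As A).
Proof.
induction As as [|A' As IH]; intros Pi A H; simpl.
- now rewrite app_nil_r.
- apply derivable_cast with (Pi ++ [A'] ++ As); [|list_eq].
  (* The fold accumulates on the left, so [A'] joins [Pi] as [A] becomes [Prod A A']. *)
  rewrite app_assoc. apply IH. apply ProdR; [exact H|apply Ax].
Qed.

Lemma derivable_prods b (S : sequent b -> Prop) A As :
  derivable S (A :: As) (fold_left (@Prod b) As A).
Proof. exact (derivable_fold_prod As (Ax S A)). Qed.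

Lemma fold_prodL b (S : sequent b -> Prop) As : forall A C,
  derivable S (A :: As) C -> derivable S [fold_left (@Prod b) As A] C.
Proof.
induction As as [|A' As IH]; intros A C H; simpl; [exact H|].
apply IH. exact (ProdL A A' [] As H).
Qed.

Lemma embed_fold_prod As : forall A : act_form,
  embed (fold_left (@Prod false) As A)
  = fold_left (@Prod true) (map (@embed false) As) (embed A).
Proof. induction As as [|A' As IH]; intro A; simpl; [easy|apply IH]. Qed.

Lemma derivable_sequent_formula (S : sequent false -> Prop) s :
  S s -> derivable S [] (sequent_formula s).
Proof.
destruct s as [[|A As] B]; intro H; simpl; [now apply Hyp|].
apply LDivR. apply fold_prodL. now apply Hyp.
Qed.

(** * From hypotheses to a context of [!]-formulas *)

Lemma bang_hyp_elim (V : list act_form) Pi B :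
  In (sequent_formula (Pi, B)) V ->
  bang_act_derivable
    (map bang (map (@embed false) V) ++ map (@embed false) Pi) (embed B).
Proof.
intro HV. apply in_split in HV. destruct HV as [V1 [V2 ->]].
set (P := map (@embed false) Pi).
(* To the right of [P] the division can consume it; afterwards the formula is permuted to the front
   and the rest of [V] is added by weakening. *)
assert (H : bang_act_derivable (P ++ [bang (embed (sequent_formula (Pi, B)))])
  (embed B)).
{ apply (@BangL true _ I). unfold P.
  destruct Pi as [|A As]; simpl; [apply Ax|].
  rewrite embed_fold_prod.
  apply (LDivL _ [] [] (derivable_prods _ _ _)).
  apply Ax. }
rewrite !map_app. simpl. rewrite <- app_assoc. simpl.
apply (bangs_weaken (b := true) I (map (@embed false) V1) []). simpl.
apply (bangs_weaken (b := true) I (map (@embed false) V2) [_]). simpl.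
rewrite <- (app_nil_r P). exact (BangP1 (b := true) I _ P [] [] H).
Qed.

Lemma embed_derivable (S : sequent false -> Prop) (V : list act_form) :
  (forall s, S s -> In (sequent_formula s) V) ->
  forall Pi C, derivable S Pi C ->
  bang_act_derivable
    (map bang (map (@embed false) V) ++ map (@embed false) Pi) (embed C).
Proof.
intros HV Pi C H. unfold bang_act_derivable.
(* The rules for [!] disappear here, since they carry a proof of [Is_true false]. *)
induction H; try contradiction; repeat (rewrite ?map_app in *; simpl in *).
- now apply bang_hyp_elim, HV.
- apply (bangs_weaken (b := true) I _ []). apply Ax.
- apply (bangs_weaken (b := true) I _ []). apply OneR.
- rewrite app_assoc. apply ZeroL.
- apply (bangs_weaken (b := true) I _ []). apply StarR0.
- apply bangs_absorb. rewrite app_assoc in *.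
  eapply derivable_cast; [exact (LDivL _ _ _ IHderivable1 IHderivable2)|list_eq].
- apply LDivR. exact (bangs_move_right (b := true) I _ [] [_] _ IHderivable).
(* The copy of [!V] from the first premise lands just after [B / A], so that formula is grouped with
   [G] before absorbing. *)
- apply derivable_cast with (map bang (map (@embed false) V) ++
    (map (@embed false) G ++ [RDiv (embed B) (embed A)]) ++
    map (@embed false) Pi ++ map (@embed false) D); [|list_eq].
  apply (bangs_absorb (b := true) I). rewrite app_assoc in IHderivable2.
  eapply derivable_cast; [exact (RDivL _ _ _ IHderivable1 IHderivable2)|list_eq].
- apply RDivR. now rewrite <- app_assoc.
- rewrite app_assoc in *. now apply ProdL.
- apply bangs_absorb. rewrite app_assoc. now apply ProdR.
- rewrite app_assoc in *. now apply OneL.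
- rewrite app_assoc in *. now apply PlusL.
- now apply PlusR1.
- now apply PlusR2.
- rewrite app_assoc in *. now apply WithL1.
- rewrite app_assoc in *. now apply WithL2.
- now apply WithR.
- rewrite app_assoc. apply StarL. intro n. specialize (H0 n).
  rewrite !map_app, map_repeat in H0. now rewrite <- app_assoc.
- rewrite concat_map.
  apply (bangs_absorb_concat (b := true) I _ _ []). simpl.
  (* Each block now carries a copy of [!V]; the extra leading one is weakened away. *)
  apply (bangs_weaken (b := true) I _ []). simpl.
  apply StarR.
  + now destruct Pis.
  + intros Pi HPi. rewrite map_map, in_map_iff in HPi.
    destruct HPi as [Pi' [<- HPi']]. now apply H1.
- apply bangs_absorb. rewrite app_assoc in *.
  eapply derivable_cast; [exact (Cut _ _ IHderivable1 IHderivable2)|list_eq].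
Qed.

(** * Interpreting [!] by [One] and [Zero] *)

Section Collapse.
Variable S : sequent false -> Prop.

(** Choosing a formula according to the truth of a proposition calls for the informative excluded
    middle. *)
Definition collapse_bang (A : act_form) : act_form :=
  if excluded_middle_informative (derivable S [] A) then One else Zero.

Fixpoint collapse (b : bool) (A : form b) : act_form :=
  match A with
  | Var n => Var n
  | Zero => Zero
  | One => One
  | LDiv A B => LDiv (collapse A) (collapse B)
  | RDiv B A => RDiv (collapse B) (collapse A)
  | Prod A B => Prod (collapse A) (collapse B)
  | Plus A B => Plus (collapse A) (collapse B)
  | With A B => With (collapse A) (collapse B)
  | Star A => Star (collapse A)
  | Bang _ A => collapse_bang (collapse A)
  end.

Lemma collapse_embed (A : act_form) : collapse (embed A) = A.
Proof. induction A; simpl; now f_equal. Qed.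

Lemma collapse_bang_derivable A :
  derivable S [] A -> collapse_bang A = One.
Proof.
intro H. unfold collapse_bang.
now destruct (excluded_middle_informative _).
Qed.

Lemma collapse_bang_cases A :
  derivable S [] A /\ collapse_bang A = One \/ collapse_bang A = Zero.
Proof.
unfold collapse_bang. destruct (excluded_middle_informative _); auto.
Qed.

Lemma OneL_inv G D {C} : derivable S (G ++ One :: D) C -> derivable S (G ++ D) C.
Proof. exact (Cut G D (OneR S)). Qed.

(** Either some entry is [Zero], which proves anything, or all are [One] and can be erased. *)
Lemma collapse_bangs_cases (Pi : list act_form) :
  (forall C, derivable S (map collapse_bang Pi) C) \/
  (forall C, derivable S (map collapse_bang Pi) C <-> derivable S [] C).
Proof.
induction Pi as [|A Pi IH]; simpl; [right; tauto|].
destruct (collapse_bang_cases A) as [[_ ->]| ->].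
- destruct IH as [IH|IH]; [left|right]; intro C.
  + apply (OneL []), IH.
  + rewrite <- IH. split; [exact (OneL_inv [] _)|exact (OneL [] _ (C := C))].
- left. intro C. apply (ZeroL S []).
Qed.

Lemma collapse_derivable (Pi : list bang_act_form) C :
  bang_act_derivable Pi C -> derivable S (map (@collapse true) Pi) (collapse C).
Proof.
unfold bang_act_derivable.
intro H. induction H; repeat (rewrite ?map_app in *; simpl in *).
- contradiction.
- apply Ax.
- apply OneR.
- apply ZeroL.
- apply StarR0.
- now apply LDivL.
- now apply LDivR.
- now apply RDivL.
- now apply RDivR.
- now apply ProdL.
- now apply ProdR.
- now apply OneL.
- now apply PlusL.
- now apply PlusR1.
- now apply PlusR2.
- now apply WithL1.
- now apply WithL2.
- now apply WithR.
- apply StarL. intro n. specialize (H0 n).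
  now rewrite !map_app, map_repeat in H0.
- rewrite concat_map. apply StarR.
  + now destruct Pis.
  + intros Pi HPi. rewrite in_map_iff in HPi.
    destruct HPi as [Pi' [<- HPi']]. now apply H1.
- now apply Cut with (collapse A).
(* Dereliction: when [!A] becomes [One], the collapse of [A] is derivable and is cut out of the
   premise. *)
- destruct (collapse_bang_cases (collapse A)) as [[HA ->]| ->].
  + apply OneL. exact (Cut _ _ HA IHderivable).
  + apply ZeroL.
- rewrite map_map in *. simpl in *.
  rewrite <- (map_map (@collapse true) collapse_bang) in *.
  destruct (collapse_bangs_cases (map (@collapse true) Pi)) as [E|E];
    [apply E|].
  (* With the context erased, the premise says that the collapse of [B] is derivable from [S], so
     [!B] becomes [One]. *)
  rewrite E in *. rewrite collapse_bang_derivable by assumption. apply OneR.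
(* Exchange: [One] is erased at its old place and inserted at the new one; [Zero] closes the goal at
   once. *)
- destruct (collapse_bang_cases (collapse A)) as [[_ E]|E]; rewrite E in *.
  + apply OneL. rewrite app_assoc in *. now apply OneL_inv.
  + apply ZeroL.
- destruct (collapse_bang_cases (collapse A)) as [[_ E]|E]; rewrite E in *.
  + rewrite app_assoc in *. apply OneL. rewrite <- app_assoc in *.
    now apply OneL_inv.
  + rewrite app_assoc. apply ZeroL.
- destruct (collapse_bang_cases (collapse A)) as [[_ ->]| ->].
  + now apply OneL.
  + apply ZeroL.
- destruct (collapse_bang_cases (collapse A)) as [[_ E]|E]; rewrite E in *.
  + now apply OneL_inv in IHderivable.
  + apply ZeroL.
Qed.

Lemma collapse_context (V Pi : list act_form) C :
  (forall A, In A V -> derivable S [] A) ->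
  derivable S (map collapse_bang V ++ Pi) C -> derivable S Pi C.
Proof.
induction V as [|A V IH]; intros HV H; simpl in *; [exact H|].
rewrite collapse_bang_derivable in H by auto.
apply IH; [auto|exact (OneL_inv [] _ H)].
Qed.

End Collapse.

Theorem theorem2p6 :
  forall (S : list (sequent false)) (Upsilon : list act_form),
    Permutation Upsilon (map sequent_formula S) ->
    forall (Pi : list act_form) (C : act_form),
      act_derivable (fun s => In s S) Pi C <->
      bang_act_derivable
        (map (fun A => bang (embed A)) Upsilon ++ map (@embed false) Pi)
        (embed C).
Proof.
intros S V HV Pi C. split; intro H.
- rewrite <- map_map. apply embed_derivable with (2 := H).
  intros s Hs. apply (Permutation_in _ (Permutation_sym HV)).
  now apply in_map.
- apply (collapse_derivable (fun s => In s S)) in H.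
  rewrite map_app, !map_map, collapse_embed in H. simpl in H.
  rewrite (map_ext _ _ (collapse_embed _)), map_id in H.
  rewrite (map_ext _ (collapse_bang (fun s => In s S))) in H
    by (intro; now rewrite collapse_embed).
  (* [Pi] and [C] are back unchanged; it remains that each formula of [V] is derivable from [S], so
     that its [!] collapses to [One]. *)
  apply collapse_context with (2 := H).
  intros A HA. apply (Permutation_in _ HV), in_map_iff in HA.
  destruct HA as [s [<- Hs]]. now apply derivable_sequent_formula.
Qed.
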